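(* Let $G$ be a graph with $m\ge 1$ edges, let $M_2=4I+B$ where $B$ is the adjacency matrix of the line graph of $G$, let $f(\mathbf{w})=\mathbf{w}^\top M_2\mathbf{w}$, and let $R=\{\mathbf{w}\in\mathbb{R}^{E(G)}:\mathbf{1}^\top\mathbf{w}=m,\ \mathbf{w}\ge 0\text{ entrywise}\}$. Let $\alpha$ be a nonempty subset of $E(G)$. Then there is a local minimum $\mathbf{w}$ of $f$ on $R$ with $\operatorname{supp}(\mathbf{w})=\alpha$ if and only if 1. $M_2[\alpha]^{-1}\mathbf{1}$ is entrywise positive, and 2. $M_2(\alpha]\,M_2[\alpha]^{-1}\mathbf{1}$ is entrywise greater than or equal to $1$. If these conditions hold, then the vector $\mathbf{w}$ given by $\mathbf{w}[\alpha]=kM_2[\alpha]^{-1}\mathbf{1}$ with $k=\dfrac{m}{\mathbf{1}^\top M_2[\alpha]^{-1}\mathbf{1}}$ and $\mathbf{w}(\alpha)=\mathbf{0}$ is the only local minimum of $f$ on $R$ with support $\alpha$.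
   Context: Graphs are finite and simple. The line graph of $G$ has vertex set $E(G)$, two distinct edges being adjacent when they share a vertex. The support $\operatorname{supp}(\mathbf{w})$ is the set of indices at which $\mathbf{w}$ is nonzero. $M_2[\alpha]$ is the principal submatrix of $M_2$ on rows and columns in $\alpha$; $M_2(\alpha]$ is the submatrix with rows not in $\alpha$ and columns in $\alpha$; $\mathbf{w}[\alpha]$ and $\mathbf{w}(\alpha)$ are the subvectors of $\mathbf{w}$ on indices in $\alpha$ and not in $\alpha$, respectively. $\mathbf{1}$ is the all-ones vector of the appropriate size. $M_2$ is positive definite. A local minimum of $f$ on $R$ is a point $\mathbf{w}\in R$ such that $f(\mathbf{w})\le f(\mathbf{v})$ for all $\mathbf{v}\in R$ sufficiently close to $\mathbf{w}$. *)

(* Defs.v *)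
From HB Require Import structures.
From mathcomp Require Import all_boot all_order all_algebra.
From mathcomp Require Import all_classical all_reals all_analysis.

Set Implicit Arguments.
Unset Strict Implicit.
Unset Printing Implicit Defensive.

Import Order.TTheory GRing.Theory Num.Theory.
Import numFieldNormedType.Exports.

Local Open Scope ring_scope.

Record sgraph := SGraph {
  vertex :> finType;
  adj : rel vertex;
  adj_sym : symmetric adj;
  adj_irr : irreflexive adj }.

(* An edge is the unordered pair of its endpoints. *)
Definition edges (G : sgraph) : {set {set G}} :=
  [set e : {set G} | [exists x : G, exists y : G, adj x y && (e == [set x; y])]].

Definition edge (G : sgraph) : finType := {e : {set G} | e \in edges G}.

Definition line_adj (G : sgraph) : rel (edge G) :=
  fun e f => (e != f) && (val e :&: val f != finset.set0).

Lemma line_adj_sym (G : sgraph) : symmetric (@line_adj G).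
Proof. by move=> e f; rewrite /line_adj eq_sym finset.setIC. Qed.

Lemma line_adj_irr (G : sgraph) : irreflexive (@line_adj G).
Proof. by move=> e; rewrite /line_adj eqxx. Qed.

Definition line_graph (G : sgraph) : sgraph :=
  SGraph (@line_adj_sym G) (@line_adj_irr G).

(* Matrices and vectors indexed by a finite type I are represented over
   'I_#|I|, through the bijection enum_val : 'I_#|I| -> I. *)
Definition adj_mx (R : realType) (H : sgraph) : 'M[R]_#|H| :=
  \matrix_(i, j) (adj (enum_val i) (enum_val j))%:R.

Definition M2 (R : realType) (G : sgraph) : 'M[R]_#|edge G| :=
  4%:M + adj_mx R (line_graph G).

Section Indexed.
Variables (R : realType) (I : finType).
Implicit Types (a b : {set I}) (A : 'M[R]_#|I|) (w : 'cV[R]_#|I|).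

Definition supp w : {set I} := [set i : I | w (enum_rank i) 0 != 0].

(* Position in 'I_#|I| of the k-th element of a. *)
Definition sub_idx a (k : 'I_#|a|) : 'I_#|I| := enum_rank (enum_val k).

(* A[a], A(a], w[a] and w(a) respectively. *)
Definition principal_submx a A : 'M[R]_#|a| :=
  mxsub (@sub_idx a) (@sub_idx a) A.
Definition off_submx a A : 'M[R]_(#|~: a|%SET, #|a|) :=
  mxsub (@sub_idx (~: a)%SET) (@sub_idx a) A.
Definition subvec a w : 'cV[R]_#|a| := rowsub (@sub_idx a) w.
Definition cosubvec a w : 'cV[R]_#|~: a|%SET := subvec (~: a)%SET w.
End Indexed.

Definition ones (R : realType) (n : nat) : 'cV[R]_n := const_mx 1.

Definition entry_sum (R : realType) (n : nat) (w : 'cV[R]_n) : R :=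
  ((ones R n)^T *m w) 0 0.

Definition quad_form (R : realType) (n : nat) (A : 'M[R]_n) (w : 'cV[R]_n) : R :=
  (w^T *m A *m w) 0 0.

Definition scaled_simplex (R : realType) (n : nat) : set 'cV[R]_n :=
  [set w | entry_sum w = n%:R /\ (forall i, 0 <= w i 0)]%classic.

Definition local_min (R : realType) (T : topologicalType) (f : T -> R)
    (D : set T) (w : T) : Prop :=
  D w /\ (\forall v \near w, D v -> f w <= f v).

(* Main.v *)
Require Import Defs.
From HB Require Import structures.
From mathcomp Require Import all_boot all_order all_algebra.
From mathcomp Require Import all_classical all_reals all_analysis.
From mathcomp Require Import ring lra.

Import Order.TTheory GRing.Theory Num.Theory.
Import numFieldNormedType.Exports.

(** Minimizing a quadratic form on a simplex is a convex problem when the form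
is positive definite, so the first-order conditions decide everything.

The matrix M2 is positive definite because M2 = 2 I + N^T N, where N is the
vertex-edge incidence matrix of G: two distinct edges share at most one vertex,
and an edge has two ends ([posdef_M2]). The rest of the argument holds for any
positive definite matrix A.

Let w lie in the simplex. Moving mass from index i to index j is feasible as
soon as w_i > 0, and its slope is twice (A w)_j - (A w)_i. So at a local
minimum (A w)_i <= (A w)_j whenever w_i > 0. Conversely, under this condition
A w takes its least value at each index of the support, whence the linear term
in the expansion of f around w is nonnegative on the simplex; the quadratic
term is nonnegative too, and w is even a global minimum
([local_min_gradientP]).

If w has support a, the condition says that A w is equal to some constant c on
a and is at least c off a. Writing A w in blocks, this is A[a] w[a] = c 1 and
A(a] w[a] >= c 1. The first equation gives w[a] = c u with u = A[a]^-1 1, and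
c > 0 since w^T A w = c 1^T w. Dividing by c, positivity of w on a becomes
condition 1 and the inequality off a becomes condition 2, while 1^T w = m fixes
c = m / 1^T u. All these steps are reversible, which gives existence, the
formula and uniqueness at once ([supp_local_minP]). *)

Set Implicit Arguments.
Unset Strict Implicit.

Local Open Scope ring_scope.

(** * Quadratic forms and positive definite matrices *)

Definition posdef (R : realType) (n : nat) (A : 'M[R]_n) : Prop :=
  A^T = A /\ (forall w : 'cV[R]_n, w != 0 -> 0 < quad_form A w).

Lemma entry_sumE (R : realType) (n : nat) (w : 'cV[R]_n) :
  entry_sum w = \sum_i w i 0.
Proof.
by rewrite /entry_sum mxE; apply: eq_bigr => i _; rewrite !mxE mul1r.
Qed.

Lemma entry_sumD (R : realType) (n : nat) (v w : 'cV[R]_n) :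
  entry_sum (v + w) = entry_sum v + entry_sum w.
Proof. by rewrite /entry_sum mulmxDr mxE. Qed.

Lemma entry_sumZ (R : realType) (n : nat) (k : R) (w : 'cV[R]_n) :
  entry_sum (k *: w) = k * entry_sum w.
Proof. by rewrite /entry_sum -scalemxAr mxE. Qed.

Lemma onesZ_entry (R : realType) (n : nat) (c : R) i j :
  (c *: ones R n) i j = c.
Proof. by rewrite !mxE mulr1. Qed.

Lemma quad_formE (R : realType) (n : nat) (A : 'M[R]_n) (w : 'cV[R]_n) :
  quad_form A w = \sum_i w i 0 * (A *m w) i 0.
Proof.
by rewrite /quad_form -mulmxA mxE; apply: eq_bigr => i _; rewrite !mxE.
Qed.

Lemma quad_formD (R : realType) (n : nat) (A : 'M[R]_n) (w d : 'cV[R]_n) :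
  A^T = A ->
  quad_form A (w + d)
    = quad_form A w + (\sum_i d i 0 * (A *m w) i 0) *+ 2 + quad_form A d.
Proof.
move=> symA.
have -> : \sum_i d i 0 * (A *m w) i 0 = (d^T *m (A *m w)) 0 0.
  by rewrite [RHS]mxE; apply: eq_bigr => i _; rewrite [in RHS]mxE.
have cross : (w^T *m (A *m d)) 0 0 = (d^T *m (A *m w)) 0 0.
  rewrite (_ : w^T *m (A *m d) = (d^T *m (A *m w))^T) ?mxE //.
  by rewrite !trmx_mul trmxK symA mulmxA.
rewrite /quad_form -!mulmxA raddfD /= !mulmxDl !mulmxDr.
rewrite 3![in LHS]mxE cross.
by rewrite !mxE mulr2n !addrA.
Qed.

Lemma quad_formZ (R : realType) (n : nat) (A : 'M[R]_n) (t : R) (w : 'cV[R]_n) :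
  quad_form A (t *: w) = t ^+ 2 * quad_form A w.
Proof.
rewrite !quad_formE mulr_sumr; apply: eq_bigr => i _.
rewrite -scalemxAr mxE [_ i 0 in X in _ * X]mxE; ring.
Qed.

Lemma posdef_ge0 (R : realType) (n : nat) (A : 'M[R]_n) (w : 'cV[R]_n) :
  posdef A -> 0 <= quad_form A w.
Proof.
move=> [_ posA]; have [->|/posA/ltW //] := eqVneq w 0.
by rewrite /quad_form mulmx0 mxE.
Qed.

(** A vector v with v A = 0 has v A v^T = 0, so it is zero. *)
Lemma posdef_unitmx (R : realType) (n : nat) (A : 'M[R]_n) :
  posdef A -> A \in unitmx.
Proof.
move=> [symA posA]; rewrite -row_free_unit; apply: inj_row_free => v vA0.
apply: trmx_inj; rewrite trmx0; apply/eqP/negP => /negP/posA.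
by rewrite /quad_form trmxK vA0 mul0mx mxE ltxx.
Qed.

(** * First-order conditions on the simplex *)

Lemma slope_ge0 (R : realType) (r b c : R) :
  0 < r -> (forall t, 0 < t < r -> 0 <= t * b + t ^+ 2 * c) -> 0 <= b.
Proof.
move=> r_gt0 H; rewrite leNgt; apply/negP => b_lt0.
have c1_gt0 : 0 < `|c| + 1 by rewrite ltr_wpDl.
(* Small enough for the quadratic term to be at most half the linear one. *)
pose t := Num.min (r / 2) (- b / 2 / (`|c| + 1)).
have t_gt0 : 0 < t by rewrite lt_min !divr_gt0 ?oppr_gt0.
have t_lt : t < r by rewrite gt_min; apply/orP; left; lra.
have : t * (`|c| + 1) <= - b / 2 by rewrite -ler_pdivlMr // ge_min lexx orbT.
have := H t; rewrite t_gt0 t_lt => /(_ isT).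
rewrite expr2 -mulrA -mulrDr pmulr_rge0 //.
have : t * c <= t * `|c| by rewrite ler_pM2l // ler_norm.
rewrite mulrDr; lra.
Qed.

Lemma local_min_direction (R : realType) (n : nat) (A : 'M[R]_n)
    (D : set 'cV[R]_n) (w d : 'cV[R]_n) (r : R) :
  A^T = A -> local_min (quad_form A) D w ->
  0 < r -> (forall t, 0 < t < r -> D (w + t *: d)) ->
  0 <= \sum_i d i 0 * (A *m w) i 0.
Proof.
move=> symA [_ /nbhs_ballP[e /= e_gt0 wmin]] r_gt0 Dd.
(* A bound on the entries of d; the added 1 keeps it nonzero when d = 0. *)
pose b := \sum_i `|d i 0| + 1.
have b_gt0 : 0 < b by rewrite ltr_wpDl // sumr_ge0.
rewrite -(pmulrn_lge0 _ (isT : (0 < 2)%N)).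
apply: (@slope_ge0 _ (Num.min r (e / b)) _ (quad_form A d)).
  by rewrite lt_min r_gt0 divr_gt0.
move=> t; rewrite lt_min => /and3P[t_gt0 t_lt_r].
rewrite ltr_pdivlMr // => tb_lt_e.
have near_w : ball w e (w + t *: d).
  split=> // i j; rewrite ord1 /ball /= !mxE opprD addNKr normrN normrM.
  rewrite gtr0_norm //; apply: le_lt_trans tb_lt_e.
  rewrite ler_pM2l // /b (bigD1 i) //= -addrA lerDl addr_ge0 //.
  by rewrite sumr_ge0.
have /(wmin _ near_w) : D (w + t *: d) by apply: Dd; rewrite t_gt0.
rewrite quad_formD // quad_formZ -addrA lerDl.
rewrite mulrnAr mulr_sumr; congr (_ <= _ *+ 2 + _).
by apply: eq_bigr => i _; rewrite [in LHS]mxE mulrA.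
Qed.

Lemma sum_delta_sub (R : realType) (n : nat) (F : 'I_n -> R) (i j : 'I_n) :
  \sum_l (delta_mx j 0 - delta_mx i 0 : 'cV[R]_n) l 0 * F l = F j - F i.
Proof.
under eq_bigr do rewrite !mxE !eqxx !andbT mulrBl !mulr_natl !mulrb.
by rewrite sumrB -!big_mkcond !big_pred1_eq.
Qed.

(** The first-order condition is sufficient because at a point w that satisfies
it, A w - (A w)_i0 is nonnegative and vanishes on the support of w, where i0 is
any index of that support; subtracting the constant (A w)_i0 does not change
the pairing with v - w, whose entries sum to zero. *)
Lemma local_min_gradientP (R : realType) (n : nat) (A : 'M[R]_n)
    (w : 'cV[R]_n) :
  posdef A -> @scaled_simplex R n w ->
  local_min (quad_form A) (@scaled_simplex R n) w <->
  (forall i j, 0 < w i 0 -> (A *m w) i 0 <= (A *m w) j 0).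
Proof.
move=> posA Dw; have [symA _] := posA; split=> [wmin i j wi_gt0|grad].
  (* Mass moves from i to j; feasible up to the time w i 0. *)
  pose d : 'cV[R]_n := delta_mx j 0 - delta_mx i 0.
  have -> : ((A *m w) i 0 <= (A *m w) j 0)
            = (0 <= \sum_l d l 0 * (A *m w) l 0).
    by rewrite sum_delta_sub subr_ge0.
  apply: local_min_direction wmin wi_gt0 _ => // t /andP[t_gt0 t_lt].
  have [sumw w_ge0] := Dw; split.
    suff sumd : entry_sum d = 0.
      by rewrite entry_sumD entry_sumZ sumd mulr0 addr0.
    rewrite entry_sumE -[RHS](subrr 1) -(sum_delta_sub (fun=> 1) i j).
    by apply: eq_bigr => l _; rewrite mulr1.
  move=> l; rewrite !mxE !eqxx !andbT; have := w_ge0 l.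
  by case: (l =P i) => [->|_]; case: (_ == j); rewrite /=; lra.
split=> //; apply/nbhs_ballP; exists 1 => //= v _ [sumv v_ge0].
have [sumw w_ge0] := Dw.
have -> : v = w + (v - w) by rewrite addrC subrK.
rewrite quad_formD // -addrA lerDl addr_ge0 ?posdef_ge0 // mulrn_wge0 //.
(* The simplex may be reduced to the empty vector, and then w is zero. *)
have [i0 wi0|w0] := pickP [pred i | 0 < w i 0]; last first.
  have -> : w = 0.
    apply/matrixP => i j; rewrite ord1 mxE; apply/eqP.
    by rewrite eq_le w_ge0 andbT leNgt; have /= -> := w0 i.
  by rewrite mulmx0 big1 // => i _; rewrite [X in _ * X]mxE mulr0.
rewrite (_ : \sum_i _
    = \sum_i (v i 0 - w i 0) * ((A *m w) i 0 - (A *m w) i0 0)).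
  apply: sumr_ge0 => i _.
  have := w_ge0 i; rewrite le_eqVlt => /orP[/eqP <-|wi_gt0].
    by rewrite subr0 mulr_ge0 // subr_ge0 grad.
  rewrite (_ : _ - (A *m w) i0 0 = 0) ?mulr0 //.
  by apply/eqP; rewrite subr_eq0 eq_le !grad.
under [RHS]eq_bigr do rewrite mulrBr.
rewrite sumrB -mulr_suml sumrB -!entry_sumE sumv sumw subrr mul0r subr0.
by apply: eq_bigr => i _; rewrite !mxE.
Qed.

(** * Splitting indices along a subset *)

Lemma enum_val_sub_idx (I : finType) (a : {set I}) (k : 'I_#|a|) :
  enum_val (sub_idx k) = enum_val k.
Proof. exact: enum_rankK. Qed.

Lemma sub_idx_inj (I : finType) (a : {set I}) : injective (@sub_idx I a).
Proof. by move=> k l /enum_rank_inj /enum_val_inj. Qed.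

Lemma sub_idxP (I : finType) (a : {set I}) (i : 'I_#|I|) :
  (exists k : 'I_#|a|, i = sub_idx k) \/
  (exists k : 'I_#|(~: a)%SET|, i = sub_idx k).
Proof.
have in_idx (b : {set I}) : enum_val i \in b ->
    exists k : 'I_#|b|, i = sub_idx k.
  move=> ib; exists (enum_rank_in ib (enum_val i)).
  by rewrite /sub_idx enum_rankK_in // enum_valK.
have [ia|ia] := boolP (enum_val i \in a); [left|right]; apply: in_idx => //.
by rewrite inE.
Qed.

Lemma sum_sub_idx (R : realType) (I : finType) (a : {set I})
    (F : 'I_#|I| -> R) :
  \sum_i F i = \sum_(k < #|a|) F (sub_idx k)
               + \sum_(k < #|(~: a)%SET|) F (sub_idx k).
Proof.
have [g gK Kg] := enum_rank_bij I.
rewrite (reindex enum_rank) /=; last by exists g => x _.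
rewrite (bigID (mem a)) /= big_enum_val; congr (_ + _).
have cE x : (x \notin a) = (x \in (~: a)%SET) by rewrite finset.in_setC.
by rewrite (eq_bigl _ _ cE) big_enum_val.
Qed.

Lemma subvec_inj (R : realType) (I : finType) (a : {set I})
    (v w : 'cV[R]_#|I|) :
  subvec a v = subvec a w -> cosubvec a v = cosubvec a w -> v = w.
Proof.
move=> eqa eqc; apply/matrixP => i j; rewrite ord1.
case: (sub_idxP a i) => [[k ->]|[k ->]].
  by move/matrixP/(_ k 0): eqa; rewrite !mxE.
by move/matrixP/(_ k 0): eqc; rewrite !mxE.
Qed.

Lemma subvec_surj (R : realType) (I : finType) (a : {set I}) (x : 'cV[R]_#|a|) :
  exists2 w : 'cV[R]_#|I|, subvec a w = x & cosubvec a w = 0.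
Proof.
exists (\col_i \sum_(k | sub_idx k == i) x k 0); apply/matrixP => k j.
  rewrite ord1 !mxE (eq_bigl (pred1 k)) ?big_pred1_eq //.
  by move=> l; rewrite /= (inj_eq (@sub_idx_inj _ _)).
rewrite !mxE big1 // => l /eqP/(congr1 enum_val); rewrite !enum_val_sub_idx.
by move=> eq_lk; have := enum_valP k; rewrite -eq_lk inE enum_valP.
Qed.

Lemma suppP (R : realType) (I : finType) (a : {set I}) (w : 'cV[R]_#|I|) :
  supp w = a <-> (forall k, subvec a w k 0 != 0) /\ cosubvec a w = 0.
Proof.
split=> [<-|[wa wc]].
  split=> [k|]; first by rewrite mxE; have := enum_valP k; rewrite inE.
  apply/matrixP => k j; rewrite ord1 !mxE; apply/eqP.
  by have := enum_valP k; rewrite !inE negbK.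
apply/setP => x; rewrite inE.
have [xa|xa] := boolP (x \in a).
  by have := wa (enum_rank_in xa x); rewrite mxE /sub_idx enum_rankK_in.
have xc : x \in (~: a)%SET by rewrite inE.
move/matrixP/(_ (enum_rank_in xc x) 0): wc.
by rewrite !mxE /sub_idx enum_rankK_in // => ->; rewrite eqxx.
Qed.

(** Only the columns in a contribute when w vanishes off a. With b equal to a or
to its complement, this is the block form of A w. *)
Lemma subvec_mulmx (R : realType) (I : finType) (a b : {set I})
    (A : 'M[R]_#|I|) (w : 'cV[R]_#|I|) :
  cosubvec a w = 0 ->
  subvec b (A *m w) = mxsub (@sub_idx I b) (@sub_idx I a) A *m subvec a w.
Proof.
move=> wc; apply/matrixP => k j; rewrite ord1 !mxE (sum_sub_idx a).
rewrite [X in _ + X]big1 ?addr0 => [|l _].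
  by apply: eq_bigr => l _; rewrite !mxE.
by move/matrixP/(_ l 0): wc; rewrite !mxE => ->; rewrite mulr0.
Qed.

Lemma entry_sum_subvec (R : realType) (I : finType) (a : {set I})
    (w : 'cV[R]_#|I|) :
  cosubvec a w = 0 -> entry_sum w = entry_sum (subvec a w).
Proof.
move=> wc; rewrite !entry_sumE (sum_sub_idx a) [X in _ + X]big1 ?addr0.
  by apply: eq_bigr => l _; rewrite mxE.
by move=> l _; move/matrixP/(_ l 0): wc; rewrite !mxE.
Qed.

Lemma quad_form_subvec (R : realType) (I : finType) (a : {set I})
    (A : 'M[R]_#|I|) (w : 'cV[R]_#|I|) :
  cosubvec a w = 0 ->
  quad_form A w = quad_form (principal_submx a A) (subvec a w).
Proof.
move=> wc; rewrite !quad_formE -subvec_mulmx // (sum_sub_idx a).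
rewrite [X in _ + X]big1 ?addr0 => [|l _].
  by apply: eq_bigr => l _; rewrite [subvec a w l 0]mxE [subvec a _ l 0]mxE.
by move/matrixP/(_ l 0): wc; rewrite [LHS]mxE [RHS]mxE => ->; rewrite mul0r.
Qed.

(** Extending by zero embeds the form of A[a] into that of A. *)
Lemma posdef_principal (R : realType) (I : finType) (a : {set I})
    (A : 'M[R]_#|I|) :
  posdef A -> posdef (principal_submx a A).
Proof.
move=> [symA posA]; split; first by rewrite trmx_mxsub symA.
move=> x x_neq0; have [w wa wc] := subvec_surj x.
rewrite -wa -quad_form_subvec // posA //; apply: contraNneq x_neq0 => w0.
by rewrite -wa w0; apply/eqP/matrixP => k j; rewrite !mxE.
Qed.

(** * Local minima with a given support *)

Lemma supp_local_minP (R : realType) (I : finType) (A : 'M[R]_#|I|)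
    (a : {set I}) (w : 'cV[R]_#|I|) :
  let u := invmx (principal_submx a A) *m ones R #|a| in
  posdef A -> a != finset.set0 ->
  local_min (quad_form A) (@scaled_simplex R #|I|) w /\ supp w = a <->
  [/\ forall i, 0 < u i 0,
      forall i, 1 <= (off_submx a A *m u) i 0,
      subvec a w = (#|I|%:R / entry_sum u) *: u
    & cosubvec a w = 0].
Proof.
move=> u posA /set0Pn[e0 e0a].
have k0 : 'I_#|a| := enum_rank_in e0a e0.
have m_gt0 : 0 < #|I|%:R :> R by rewrite ltr0n; apply/card_gt0P; exists e0.
have unitAa := posdef_unitmx (posdef_principal a posA).
have Au : principal_submx a A *m u = ones R _ by rewrite mulKVmx.
split=> [[wmin /suppP[wa wc]]|[u_gt0 off_ge1 wa wc]].
- have Dw := wmin.1; have [sumw w_ge0] := Dw.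
  have grad := (local_min_gradientP posA Dw).1 wmin.
  have wa_gt0 k : 0 < subvec a w k 0 by rewrite lt_def wa mxE w_ge0.
  (* The common value of A w on the support; k0 is an arbitrary index of it. *)
  pose lam := (A *m w) (sub_idx k0) 0.
  have Awa : principal_submx a A *m subvec a w = lam *: ones R _.
    rewrite -subvec_mulmx //; apply/matrixP => k j.
    rewrite ord1 onesZ_entry [LHS]mxE.
    by apply/eqP; rewrite eq_le !grad //; [have := wa_gt0 k0|have := wa_gt0 k];
       rewrite mxE.
  have wau : subvec a w = lam *: u.
    by rewrite -[LHS](mulKmx unitAa) Awa -scalemxAr.
  (* Positive since w^T A w = lam * 1^T w. *)
  have lam_gt0 : 0 < lam.
    have w_neq0 : w != 0.
      by apply: contraNneq (wa k0) => ->; rewrite !mxE.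
    have := posA.2 w w_neq0; rewrite (quad_form_subvec _ wc) quad_formE Awa.
    under eq_bigr do rewrite onesZ_entry.
    rewrite -mulr_suml -entry_sumE -entry_sum_subvec // sumw.
    by rewrite pmulr_rgt0.
  have m_eq : #|I|%:R = lam * entry_sum u.
    by rewrite -sumw (entry_sum_subvec wc) wau entry_sumZ.
  have sumu_neq0 : entry_sum u != 0.
    by apply: contraTneq m_gt0 => u0; rewrite m_eq u0 mulr0 ltxx.
  split=> //.
  + by move=> k; have := wa_gt0 k; rewrite wau mxE pmulr_rgt0.
  + move=> l; rewrite -(ler_pM2l lam_gt0) mulr1.
    have -> : lam * (off_submx a A *m u) l 0 = (A *m w) (sub_idx l) 0.
      have /matrixP/(_ l 0) := subvec_mulmx (~: a)%SET A wc.
      by rewrite wau -scalemxAr [LHS]mxE [RHS]mxE => ->.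
    by apply: grad; have := wa_gt0 k0; rewrite mxE.
  + by rewrite wau m_eq mulfK.
- pose k := #|I|%:R / entry_sum u.
  have sumu_gt0 : 0 < entry_sum u.
    rewrite entry_sumE (bigD1 k0) //= ltr_pwDl ?u_gt0 // sumr_ge0 // => i _.
    exact: ltW.
  have k_gt0 : 0 < k by rewrite divr_gt0.
  have wa_gt0 l : 0 < subvec a w l 0 by rewrite wa mxE mulr_gt0.
  have Dw : @scaled_simplex R #|I| w.
    split; first by rewrite (entry_sum_subvec wc) wa entry_sumZ divfK ?gt_eqF.
    move=> i; case: (sub_idxP a i) => [[l ->]|[l ->]].
      by have := wa_gt0 l; rewrite mxE => /ltW.
    by move/matrixP/(_ l 0): wc; rewrite !mxE => ->.
  have Awa l : (A *m w) (@sub_idx I a l) 0 = k.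
    have /matrixP/(_ l 0) := subvec_mulmx a A wc.
    by rewrite wa -scalemxAr Au onesZ_entry [LHS]mxE.
  have Awc l : k <= (A *m w) (@sub_idx I (~: a)%SET l) 0.
    have /matrixP/(_ l 0) := subvec_mulmx (~: a)%SET A wc.
    rewrite wa -scalemxAr [LHS]mxE [RHS]mxE => ->.
    by rewrite ler_peMr // ltW.
  split; last by apply/suppP; split=> // l; rewrite gt_eqF.
  apply/(local_min_gradientP posA Dw) => i j.
  case: (sub_idxP a i) => [[l ->] _|[l ->]]; last first.
    by move/matrixP/(_ l 0): wc; rewrite !mxE => ->; rewrite ltxx.
  by rewrite Awa; case: (sub_idxP a j) => [[l' ->]|[l' ->]] //; rewrite Awa.
Qed.

(** * Positive definiteness of 4 I + B *)

Lemma card_edge (G : sgraph) (e : edge G) : #|val e| = 2%N.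
Proof.
have := valP e; rewrite inE => /existsP[x /existsP[y /andP[xy /eqP ->]]].
by rewrite cards2; case: eqP xy => // ->; rewrite adj_irr.
Qed.

(** Two edges with two common vertices are equal, so distinct edges share one
vertex or none. *)
Lemma card_edgeI (G : sgraph) (e f : edge G) :
  #|val e :&: val f| = ((e == f).*2 + line_adj e f)%N.
Proof.
rewrite /line_adj; have [->|ef] := eqVneq e f.
  by rewrite finset.setIid card_edge.
rewrite -card_gt0 /=; suff : (#|val e :&: val f| < 2)%N by case: #|_| => [|[]].
rewrite ltnNge; apply: contra ef => card_ge2.
have sub (g h : edge G) : (2 <= #|val g :&: val h|)%N -> val g \subset val h.
  by move=> gh; apply/finset.setIidPl/eqP;
     rewrite eqEcard finset.subsetIl card_edge.
by apply/eqP/val_inj/eqP; rewrite finset.eqEsubset !sub // finset.setIC.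
Qed.

(** This is M2 = 2 I + N^T N, with N the incidence matrix: the (i, j) entry of
N^T N counts the vertices common to the edges i and j. *)
Lemma M2_entry (R : realType) (G : sgraph) (i j : 'I_#|edge G|) :
  M2 R G i j = (i == j)%:R *+ 2
    + \sum_(v : G) (v \in val (enum_val i))%:R * (v \in val (enum_val j))%:R.
Proof.
have -> : \sum_(v : G) (v \in val (enum_val i))%:R * (v \in val (enum_val j))%:R
  = #|val (enum_val i) :&: val (enum_val j)|%:R :> R.
  rewrite -sum1_card natr_sum [RHS]big_mkcond /=; apply: eq_bigr => v _.
  by rewrite finset.in_setI -natrM mulnb; case: ifP.
rewrite card_edgeI (inj_eq enum_val_inj) !mxE natrD /= -mul2n natrM.
case: (i == j) => /=; rewrite ?mulr0n ?mulr1n; lra.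
Qed.

(** With M2 = 2 I + N^T N the form is w^T M2 w = 2 |w|^2 + |N w|^2. *)
Lemma posdef_M2 (R : realType) (G : sgraph) : posdef (M2 R G).
Proof.
split=> [|w w_neq0].
  apply/matrixP => i j; rewrite mxE !M2_entry eq_sym; congr (_ + _).
  by apply: eq_bigr => v _; rewrite mulrC.
suff -> : quad_form (M2 R G) w = (\sum_i w i 0 ^+ 2) *+ 2
    + \sum_(v : G) (\sum_(i < #|edge G|)
        (v \in val (enum_val i))%:R * w i 0) ^+ 2.
  rewrite ltr_pwDl //; last by apply: sumr_ge0 => v _; exact: sqr_ge0.
  rewrite pmulrn_lgt0 //; have /cV0Pn[i wi] := w_neq0.
  rewrite (bigD1 i) //= ltr_pwDl ?exprn_even_gt0 //.
  by apply: sumr_ge0 => j _; exact: sqr_ge0.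
rewrite quad_formE.
have -> : \sum_i w i 0 * (M2 R G *m w) i 0 = \sum_i (w i 0 ^+ 2 *+ 2
   + \sum_(v : G) \sum_(j < #|edge G|) ((v \in val (enum_val i))%:R * w i 0) *
       ((v \in val (enum_val j))%:R * w j 0)).
  apply: eq_bigr => i _; rewrite mxE.
  under eq_bigr do rewrite M2_entry mulrDl.
  rewrite big_split /= mulrDr; congr (_ + _).
    rewrite (bigD1 i) //= eqxx big1 => [|j /negPf ji]; first
      by rewrite addr0 mulr1n expr2 !mulr2n mulrDl mul1r mulrDr.
    by rewrite eq_sym ji mul0rn mul0r.
  rewrite exchange_big /= mulr_sumr; apply: eq_bigr => j _.
  rewrite mulr_suml mulr_sumr; apply: eq_bigr => v _; ring.
rewrite big_split /= -sumrMnl; congr (_ + _).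
rewrite exchange_big; apply: eq_bigr => v _ /=.
by rewrite expr2 mulr_suml; apply: eq_bigr => i _; rewrite mulr_sumr.
Qed.

(** * The theorem *)

Unset Implicit Arguments.
Set Strict Implicit.

Theorem proposition4p17 (R : realType) (G : sgraph) (alpha : {set edge G}) :
  let m := #|edge G| in
  let M := M2 R G in
  let f := quad_form M in
  let D := @scaled_simplex R m in
  let Ma := principal_submx alpha M in
  let u := invmx Ma *m ones R #|alpha| in
  let cond1 := forall i, 0 < u i 0 in
  let cond2 := forall i, 1 <= (off_submx alpha M *m u) i 0 in
  (1 <= m)%N ->
  alpha != finset.set0 ->
  ((exists w : 'cV[R]_m, local_min f D w /\ supp w = alpha) <->
     cond1 /\ cond2)
  /\
  (cond1 /\ cond2 ->
   exists w : 'cV[R]_m,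
     let k := m%:R / entry_sum u in
     [/\ subvec alpha w = k *: u,
         cosubvec alpha w = 0,
         local_min f D w,
         supp w = alpha
       & forall v : 'cV[R]_m, local_min f D v -> supp v = alpha -> v = w]).
Proof.
move=> m M f D Ma u cond1 cond2 _ alpha_neq0.
have minP w := supp_local_minP w (posdef_M2 R G) alpha_neq0.
split=> [|[c1 c2]].
  split=> [[w /minP[]] //|[c1 c2]].
  have [w wa wc] := subvec_surj ((m%:R / entry_sum u) *: u).
  by exists w; apply/minP.
have [w wa wc] := subvec_surj ((m%:R / entry_sum u) *: u).
have [wmin suppw] : local_min f D w /\ supp w = alpha by apply/minP.
exists w; split=> // v vmin suppv.
have /minP[_ _ va vc] := conj vmin suppv.
by apply: (@subvec_inj _ _ alpha); rewrite ?va ?vc.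
Qed.
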